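(* Let $\alpha\in(0,1)$, $K\ge1$ and $m\ge 1$ be such that $\alpha>1/(m+1)$, and let $x$ be a context. With the reduced grid $\Gamma_m=\{\gamma_1<\cdots<\gamma_R\}$, shells $\mathcal A_j(x)$, index set $\mathcal J(x)$ and regional losses $L_j(z;x)$ as defined in the context, assume $L_j(z;x)<+\infty$ for every $z\in\mathcal Z(x)$ and every $j\in\mathcal J(x)$. Then the joint problem $$\widehat V_{m,K}(x)=\inf_{z\in\mathcal Z(x),\ \nu\in\mathcal P_K(\Gamma_m)}\mathcal R_{\alpha,\nu,x}\bigl(c(z,\cdot)\bigr)$$ is equivalent to (in particular has the same optimal value as) $$\begin{aligned}\inf_{z\in\mathcal Z(x),\ t\in\mathbb R,\ u\in\mathbb R_+^R}\quad& t+\frac1\alpha\sum_{i=1}^Ru_i\\ \text{s.t.}\quad& t+\sum_{i=R-j+1}^{R}\frac{u_i}{\gamma_i}\ge L_j(z;x),\qquad j\in\mathcal J(x),\\ &\|u\|_0\le K.\end{aligned}$$ If $(z^\star,t^\star,u^\star)$ is optimal for the latter problem and $\lambda^\star:=\sum_{i=1}^Ru_i^\star>0$, then the context-dependent tuning rule, i.e. an aggregation rule that together with $z^\star$ is optimal for the joint problem, is $$\widehat\nu_{m,K}(x)=\sum_{i:\,u_i^\star>0}\widehat w_i(x)\,\delta_{\gamma_i},\qquad \widehat w_i(x)=\frac{u_i^\star}{\lambda^\star}.$$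
   Context: Setting. $\mathcal X,\mathcal Y$ are standard Borel spaces; $\mathcal P(\mathcal Y)$ is the set of probability measures on $\mathcal Y$; $\mathcal Z(x)$ is the feasible decision set at context $x$; $c(z,y)$ is a real-valued cost with $c(z,\cdot)$ measurable. A tuning sample $\mathcal D_m=(X_i,Y_i)_{i=1}^m$ in $\mathcal X\times\mathcal Y$ is fixed. $\|u\|_0$ is the number of nonzero entries of $u$; empty sums are $0$. Conformal sets (built from $\mathcal D_m$). For a fixed measurable score $s:\mathcal X\times\mathcal Y\to\mathbb R$ put $S_i=s(X_i,Y_i)$; for $\gamma\in(0,1)$ let $k_\gamma=\lceil(m+1)(1-\gamma)\rceil$, let $\widehat q_{1-\gamma}$ be the $k_\gamma$-th smallest value among $S_1,\dots,S_m$ ($+\infty$ if $k_\gamma=m+1$), and $\mathcal C_\gamma(x)=\{y\in\mathcal Y:s(x,y)\le\widehat q_{1-\gamma}\}$. These sets decrease as $\gamma$ increases. Grid. Start from $\{r/(m+1): r=1,\ldots,m,\ r/(m+1)<\alpha\}$; if several levels generate the same conformal region, only the smallest such level is retained. The resulting reduced grid is $\Gamma_m=\{\gamma_1<\cdots<\gamma_R\}$. Aggregation rules and robust risk. $\mathcal P_K(\Gamma_m)=\{\sum_{k=1}^Kw_k\delta_{\eta_k}:\eta_k\in\Gamma_m,\ w_k\ge0,\ \sum_kw_k=1\}$, the probability measures on $\Gamma_m$ supported on at most $K$ levels. For $\nu\in\mathcal P_K(\Gamma_m)$, $$\mathfrak U_\alpha^\nu(x)=\left\{\mathbb Q\in\mathcal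 P(\mathcal Y):\ \int\frac{1-\mathbb Q(\mathcal C_\gamma(x))}{\gamma}\,\nu(\mathrm d\gamma)\le\frac1\alpha\right\},\qquad \mathcal R_{\alpha,\nu,x}(c(z,\cdot))=\sup_{\mathbb Q\in\mathfrak U_\alpha^\nu(x)}\int_{\mathcal Y}c(z,y)\,\mathbb Q(\mathrm dy).$$ Shells of the full grid. $\mathcal A_0(x)=\mathcal C_{\gamma_R}(x)$, assumed nonempty; $\mathcal A_j(x)=\mathcal C_{\gamma_{R-j}}(x)\setminus\mathcal C_{\gamma_{R-j+1}}(x)$ for $1\le j\le R-1$; $\mathcal A_R(x)=\mathcal Y\setminus\mathcal C_{\gamma_1}(x)$. $\mathcal J(x)=\{j\in\{0,\ldots,R\}:\mathcal A_j(x)\ne\varnothing\}$, and $L_j(z;x)=\sup_{y\in\mathcal A_j(x)}c(z,y)$ for $j\in\mathcal J(x)$. *)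

(* Defs.v *)
From HB Require Import structures.
From mathcomp Require Export all_boot all_order all_algebra.
From mathcomp Require Export all_classical all_reals all_analysis.

Set Implicit Arguments.
Unset Strict Implicit.
Unset Printing Implicit Defensive.

Export Order.TTheory GRing.Theory Num.Theory numFieldNormedType.Exports.

Local Open Scope classical_set_scope.
Local Open Scope ring_scope.

(* T is isomorphic, as a measurable space, to a Polish space (separable,
   complete metric) S with its Borel sigma-algebra.  Hausdorff turns the
   pseudometric of S into a metric. *)
Definition standard_borel (R : realType) (d : measure_display)
    (T : measurableType d) : Prop :=
  exists (S : completePseudoMetricType R) (f : T -> S),
    [/\ bijective f,
        hausdorff_space S,
        (exists2 E : set S, countable E & dense E)
      & forall A : set T,
          measurable A <-> <<s [set U : set S | open U] >> (f @` A)].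

Definition conformal_rank (R : realType) (m : nat) (gamma : R) : nat :=
  `|Num.ceil (m.+1%:R * (1 - gamma))|%N.

Definition full_grid (R : realType) (m : nat) (alpha : R) : seq R :=
  [seq g <- [seq r%:R / m.+1%:R | r <- iota 1 m] | g < alpha].

Section ConformalSets.
Context {R : realType} {dX dY : measure_display}.
Context {X : measurableType dX} {Y : measurableType dY}.
Context {m : nat}.
Variables (s : X * Y -> R) (Dm : m.-tuple (X * Y)).

Definition conformal_quantile (gamma : R) : \bar R :=
  if (conformal_rank m gamma <= m)%N
  then (nth 0 (sort <=%R [seq s p | p <- Dm]) (conformal_rank m gamma).-1)%:E
  else +oo%E.

Definition conformal_set (gamma : R) (x : X) : set Y :=
  [set y | ((s (x, y))%:E <= conformal_quantile gamma)%E].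

(* The conformal region of a level is the whole set-valued map
   x |-> conformal_set g x, so the grid does not depend on the context.
   The sequence is strictly increasing. *)
Definition grid (alpha : R) : seq R :=
  [seq g <- full_grid m alpha |
    `[< forall g', g' \in full_grid m alpha -> g' < g ->
          ~ (forall x, conformal_set g' x = conformal_set g x) >]].

(* 1-based: level alpha 1 < ... < level alpha (size (grid alpha)). *)
Definition level (alpha : R) (i : nat) : R := nth 0 (grid alpha) i.-1.

(* A probability on the grid is a Borel probability on the real line; as such
   it is determined by its values on the measurable sets. *)
Definition agg_rules (alpha : R) (K : nat) :
    set (probability (measurableTypeR R) R) :=
  [set nu | exists (eta w : 'I_K -> R),
    [/\ forall k, eta k \in grid alpha,
        forall k, 0 <= w k,
        \sum_(k < K) w k = 1
      & forall A : set (measurableTypeR R), measurable A ->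
          nu A = (\sum_(k < K) (w k)%:E * \d_(eta k) A)%E]].

Definition ambiguity_set (alpha : R) (nu : probability (measurableTypeR R) R)
    (x : X) : set (probability Y R) :=
  [set Q | (\int[nu]_(g in [set` grid alpha])
              ((1 - Q (conformal_set g x)) * (g^-1)%:E) <= (alpha^-1)%:E)%E].

(* The integral is the difference of the integrals of the positive and negative
   parts; for f bounded above, as under finite regional losses, it is a
   well-defined element of [-oo, +oo[. *)
Definition robust_risk (alpha : R) (nu : probability (measurableTypeR R) R)
    (x : X) (f : Y -> R) : \bar R :=
  ereal_sup [set (\int[Q]_y (f y)%:E)%E | Q in ambiguity_set alpha nu x].

Definition shell (alpha : R) (x : X) (j : nat) : set Y :=
  let r := size (grid alpha) in
  if j == 0%N then conformal_set (level alpha r) x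
  else if j == r then ~` conformal_set (level alpha 1) x
  else conformal_set (level alpha (r - j)) x
         `\` conformal_set (level alpha (r - j + 1)) x.

Definition shell_index (alpha : R) (x : X) : set nat :=
  [set j | (j <= size (grid alpha))%N /\ shell alpha x j !=set0].

Section DecisionProblems.
Context {D : Type}.
Variables (Z : X -> set D) (c : D -> Y -> R).

Definition regional_loss (alpha : R) (x : X) (z : D) (j : nat) : \bar R :=
  ereal_sup [set (c z y)%:E | y in shell alpha x j].

Definition joint_value (alpha : R) (K : nat) (x : X) : \bar R :=
  ereal_inf [set robust_risk alpha nu x (c z)
            | z in Z x & nu in agg_rules alpha K].

Definition joint_optimal (alpha : R) (K : nat) (x : X) (z : D)
    (nu : probability (measurableTypeR R) R) : Prop :=
  [/\ Z x z, agg_rules alpha K nu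
    & forall z' nu', Z x z' -> agg_rules alpha K nu' ->
        (robust_risk alpha nu x (c z) <= robust_risk alpha nu' x (c z'))%E].

(* Here u is indexed from 0, so that u 0 i belongs to level i.+1. *)
Definition reform_feasible (alpha : R) (K : nat) (x : X) (z : D) (t : R)
    (u : 'rV[R]_(size (grid alpha))) : Prop :=
  [/\ Z x z,
      forall i, 0 <= u 0 i,
      forall j, shell_index alpha x j ->
        (regional_loss alpha x z j <=
          (t + \sum_(i < size (grid alpha) |
                      (size (grid alpha) - j + 1 <= i.+1)%N)
                 u 0 i / level alpha i.+1)%:E)%E
    & (#|[pred i | u 0%R i != 0%R]| <= K)%N].

Definition reform_objective (alpha t : R) (u : 'rV[R]_(size (grid alpha))) : R :=
  t + alpha^-1 * \sum_i u 0 i.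

Definition reform_value (alpha : R) (K : nat) (x : X) : \bar R :=
  ereal_inf [set v | exists z t (u : 'rV[R]_(size (grid alpha))),
    reform_feasible K x z t u /\ v = (reform_objective t u)%:E].

Definition reform_optimal (alpha : R) (K : nat) (x : X) (z : D) (t : R)
    (u : 'rV[R]_(size (grid alpha))) : Prop :=
  reform_feasible K x z t u /\
  forall z' t' (u' : 'rV[R]_(size (grid alpha))),
    reform_feasible K x z' t' u' ->
    reform_objective t u <= reform_objective t' u'.

End DecisionProblems.
End ConformalSets.

(* Main.v *)
From HB Require Import structures.
From mathcomp Require Import measurable_realfun ring lra zify.
Require Import Defs.

(** Fix a decision z and an aggregation rule nu, with p_i its mass at the level
gamma_i.  Exchanging the integral over levels with the one over outcomes turns
the constraint that defines the ambiguity set into a single moment constraint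
E_Q[h] <= 1/alpha, where
   h(y) = sum_i (p_i / gamma_i) 1[y outside C_(gamma_i)(x)] >= 0
([shortfall], [ambiguity_integralE]).  Maximizing E_Q[c(z, .)] under one moment
constraint has a two-variable dual, and there is no gap: the robust risk is at
most v iff some affine function t + l h with l >= 0 dominates c(z, .) pointwise
and t + l / alpha <= v ([moment_duality], [robust_risk_le]).  One half is
integration of the pointwise bound.  For the other half, measures with one or
two atoms suffice to bound every slope from a point with h > 1/alpha by every
slope to a point with h < 1/alpha, so that a separating multiplier l exists;
the innermost region A_0, where h = 0 < 1/alpha, is the Slater point.

The conformal sets are nested, so that a point of the shell A_j lies outside
exactly the regions of the last j levels, and h is constant on A_j.  The
pointwise domination is therefore the finite family of constraints indexed by
J(x) ([regional_constraintsE]).  What remains is the change of variables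
u_i = l p_i: it absorbs the bilinear term l h, its total mass is l, and it has
the support of p, so that at most K levels are used iff u has at most K nonzero
entries.  It is undone by p_i = u_i / sum_j u_j when u is not 0
([rule_of_reform]); when u = 0 the bound t dominates c(z, .) by itself and any
rule will do.  Both problems thus have the same sublevel sets in z, whence the
equality of values and the optimality of the normalized rule. *)

Set Implicit Arguments.
Unset Strict Implicit.
Unset Printing Implicit Defensive.

Local Open Scope classical_set_scope.
Local Open Scope ring_scope.

(** * Finitely supported probabilities *)

Section AtomicProbability.
Context {d : measure_display} {T : measurableType d} {R : realType} {n : nat}.
Variables (a : 'I_n -> T) (w : 'I_n -> R).
Hypotheses (w_ge0 : forall i, 0 <= w i) (w_sum1 : \sum_i w i = 1).

Let atom (k : nat) : {measure set T -> \bar R} :=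
  if insub k is Some i then mscale (NngNum (w_ge0 i)) (dirac (a i)) else mzero.

(** The finite mixture of Dirac masses at the a i with weights w i. *)
Definition atomic : set T -> \bar R := msum atom n.

HB.instance Definition _ := Measure.on atomic.

Lemma atomicE A : atomic A = (\sum_i (w i)%:E * \d_(a i) A)%E.
Proof. by rewrite /atomic /msum; apply: eq_bigr => i _; rewrite /atom valK. Qed.

Let atomic_setT : atomic setT = 1%E.
Proof.
rewrite atomicE -[RHS]/(1%:E) -w_sum1 -sumEFin.
by apply: eq_bigr => i _; rewrite diracT mule1.
Qed.

HB.instance Definition _ :=
  Measure_isProbability.Build _ _ _ atomic atomic_setT.

Definition atomic_probability : probability T R := atomic.

Let ge0_integral_atomic (f : T -> R) : measurable_fun setT f ->
  (forall y, 0 <= f y) ->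
  (\int[atomic_probability]_y (f y)%:E = (\sum_i w i * f (a i))%:E)%E.
Proof.
move=> /measurable_EFinP mf f0; rewrite ge0_integral_measure_sum//; last first.
  by move=> y _; rewrite lee_fin.
rewrite -sumEFin; apply: eq_bigr => i _; rewrite /atom valK/=.
rewrite ge0_integral_mscale//=; last by move=> y _; rewrite lee_fin.
by rewrite integral_dirac// diracT mul1e.
Qed.

Lemma integral_atomic (f : T -> R) : measurable_fun setT f ->
  (\int[atomic_probability]_y (f y)%:E = (\sum_i w i * f (a i))%:E)%E.
Proof.
move=> mf; rewrite integralE.
have -> : (fun y => (f y)%:E) = EFin \o f by [].
rewrite funerpos funerneg !ge0_integral_atomic//=.
- rewrite -EFinB -sumrB; congr EFin; apply: eq_bigr => i _; rewrite -mulrBr.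
  by congr (_ * _); rewrite -[in RHS](funrposBneg f).
- exact: measurable_funrneg.
- exact: measurable_funrpos.
Qed.

End AtomicProbability.

(** * Duality for a single moment constraint *)

Section MomentDuality.
Context {d : measure_display} {T : measurableType d} {R : realType}.
Implicit Types (f h : T -> R) (b v : R).

Lemma integral_dirac_EFin f y : measurable_fun setT f ->
  (\int[\d_y : probability T R]_x (f x)%:E = (f y)%:E)%E.
Proof.
by move=> /measurable_EFinP mf; rewrite integral_dirac// diracT mul1e.
Qed.

Lemma two_point_probability (y1 y2 : T) (p : R) : 0 <= p <= 1 ->
  exists Q : probability T R, forall f, measurable_fun setT f ->
    (\int[Q]_y (f y)%:E = (p * f y1 + (1 - p) * f y2)%:E)%E.
Proof.
move=> p01.
pose a (i : 'I_2) := if i == 0 then y1 else y2.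
pose w (i : 'I_2) := if i == 0 then p else 1 - p.
have w0 i : 0 <= w i by rewrite /w; case: ifP => _; lra.
have w1 : \sum_i w i = 1 by rewrite !big_ord_recl big_ord0 /w/=; lra.
exists (atomic_probability a w0 w1) => f mf.
by rewrite integral_atomic// !big_ord_recl big_ord0 /w /a/= addr0.
Qed.

(** Weak duality.  Only the majorant is known to be integrable: f may have
integral -oo, so positive and negative parts are compared separately. *)
Lemma integral_le_affine (Q : probability T R) f h (b t l : R) :
  measurable_fun setT f -> measurable_fun setT h -> (forall y, 0 <= h y) ->
  0 <= l -> (forall y, f y <= t + l * h y) ->
  (\int[Q]_y (h y)%:E <= b%:E)%E ->
  (\int[Q]_y (f y)%:E <= (t + l * b)%:E)%E.
Proof.
move=> mf mh h0 l0 fh hb.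
have mg : measurable_fun setT (fun y => t + l * h y).
  by apply: measurable_funD => //; exact: measurable_funM.
have ih : Q.-integrable setT (EFin \o h).
  apply/integrableP; split; first exact/measurable_EFinP.
  under eq_integral do rewrite /= ger0_norm//.
  exact: le_lt_trans hb (ltry _).
apply: (@le_trans _ _ (\int[Q]_y (t + l * h y)%:E)%E).
  rewrite integralE [leRHS]integralE; apply: leeB.
  - apply: ge0_le_integral => //.
    + exact/measurable_funepos/measurable_EFinP.
    + exact/measurable_funepos/measurable_EFinP.
    + move=> y _; apply: (@funepos_le _ _ setT); last by rewrite inE.
      by move=> {}y _; rewrite lee_fin.
  - apply: ge0_le_integral => //.
    + exact/measurable_funeneg/measurable_EFinP.
    + exact/measurable_funeneg/measurable_EFinP.
    + move=> y _; apply: (@funeneg_le _ _ setT); last by rewrite inE.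
      by move=> {}y _; rewrite lee_fin.
under eq_integral do rewrite EFinD EFinM.
rewrite integralD//; last 2 first.
- exact: finite_measure_integrable_cst.
- exact: integrableZl.
rewrite integral_cst// integralZl//= probability_setT mule1.
by rewrite EFinD EFinM leeD2l// lee_wpmul2l// lee_fin.
Qed.

(** In the plane of the pairs (h y, f y), the claim on the left says that the
convex hull of these points, cut at abscissa at most b, stays below height v;
the claim on the right gives a line of slope l >= 0 through a point (b, v')
with v' <= v that lies above all of them.  The hull only has to be tested on
segments that cross the abscissa b, i.e. on measures with two atoms.  The point
y0 with h y0 < b rules out a vertical separating line. *)
Lemma moment_duality f h b v :
  measurable_fun setT f -> measurable_fun setT h -> (forall y, 0 <= h y) ->
  (exists y, h y < b) ->
  (forall Q : probability T R, (\int[Q]_y (h y)%:E <= b%:E)%E ->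
     (\int[Q]_y (f y)%:E <= v%:E)%E) <->
  (exists t l : R, [/\ 0 <= l, forall y, f y <= t + l * h y & t + l * b <= v]).
Proof.
move=> mf mh h0 [y0 hy0]; split; last first.
  move=> [t [l [l0 fh tlb]]] Q hQ.
  have := integral_le_affine mf mh h0 l0 fh hQ.
  by move/le_trans; apply; rewrite lee_fin.
move=> sup_le.
have below y : h y <= b -> f y <= v.
  move=> hyb; rewrite -lee_fin -(integral_dirac_EFin _ mf).
  by apply: sup_le; rewrite integral_dirac_EFin// lee_fin.
(* Both sides compare with the height of the segment from y' to y above b: the
   slopes to the right of (b, v) are at most the slopes to its left. *)
have cross y y' : h y' < b -> b < h y ->
    (f y - v) / (h y - b) <= (v - f y') / (b - h y').
  move=> hy' hy.
  (* The weight that makes the constraint tight: p h(y) + (1 - p) h(y') = b. *)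
  pose p := (b - h y') / (h y - h y').
  have p01 : 0 <= p <= 1.
    by rewrite /p ler_pdivrMr ?divr_ge0//; lra.
  have [Q QE] := two_point_probability y y' p01.
  have := sup_le Q; rewrite !QE// !lee_fin => H.
  have E : p * h y + (1 - p) * h y' = b by rewrite /p; field; lra.
  have {}H := H ltac:(by rewrite E).
  rewrite ler_pdivrMr ?subr_gt0// mulrAC ler_pdivlMr ?subr_gt0//.
  have D0 : 0 < h y - h y' by lra.
  have pD : p * (h y - h y') = b - h y' by rewrite /p; field; lra.
  have := ler_wpM2r (ltW D0) H.
  have -> : (p * f y + (1 - p) * f y') * (h y - h y') =
    p * (h y - h y') * (f y - f y') + f y' * (h y - h y') by ring.
  rewrite pD; lra.
(* The supremum of S is the least admissible slope; the element 0 keeps it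
   nonnegative even if no point lies to the right of b. *)
pose S := [set r | r = 0 \/ exists2 y, b < h y & r = (f y - v) / (h y - b)].
have Sub y' : h y' < b -> ubound S ((v - f y') / (b - h y')).
  move=> hy' r [->|[y hy ->]]; last exact: cross.
  by rewrite divr_ge0//; have := below y' (ltW hy'); lra.
have S0 : S !=set0 by exists 0; left.
have supS : has_sup S by split => //; exists ((v - f y0) / (b - h y0)); exact: Sub.
exists (v - sup S * b), (sup S); split; last lra.
- by apply: sup_upper_bound => //; left.
- move=> y; case: (ltrgtP (h y) b) => hy.
  + have : sup S <= (v - f y) / (b - h y) by apply: sup_le_ub => //; exact: Sub.
    rewrite ler_pdivlMr ?subr_gt0//; lra.
  + have : (f y - v) / (h y - b) <= sup S.
      by apply: sup_upper_bound => //; right; exists y.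
    rewrite ler_pdivrMr ?subr_gt0//; lra.
  + have := below y; rewrite hy lexx => /(_ isT); lra.
Qed.

End MomentDuality.

(** * The grid and its nested regions *)

(** Every subset of a finite set of reals is Borel, so f can be an arbitrary
function of the level, such as the miscoverage ratio (1 - Q (C_g x)) / g. *)
Lemma integral_finite_set (R : realType)
    (mu : probability (measurableTypeR R) R) (l : seq R) (f : R -> \bar R) :
  uniq l -> (forall g, g \in l -> (0 <= f g)%E) ->
  (\int[mu]_(g in [set` l]) f g = \sum_(g <- l) f g * mu [set g])%E.
Proof.
move=> ul f0.
have Dl : [set` l] = \big[setU/set0]_(g <- l) [set g].
  by rewrite -bigcup_seq; apply/seteqP; split => [g gl|g [g' g'l ->]//]; exists g.
have ml (A : set (measurableTypeR R)) : A `<=` [set` l] -> measurable A.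
  move=> Al; apply: countable_measurable.
    by move=> t; exact: measurable_set1.
  by apply: finite_set_countable; apply: sub_finite_set Al _; exact: finite_seq.
rewrite Dl (@ge0_integral_bigsetU _ (measurableTypeR R))//.
- apply: eq_bigr => g _.
  rewrite (eq_integral (cst (f g))); last by move=> z; rewrite inE => ->.
  by rewrite integral_cst//; exact: measurable_set1.
- by apply/trivIsetP => g g' _ _ /eqP gg'; apply/seteqP; split => // z [/= -> /gg'].
- by rewrite -Dl => _ B mB; apply: ml => z [].
- by rewrite -Dl.
Qed.

Section Grid.
Context {R : realType} {dX dY : measure_display}.
Context {X : measurableType dX} {Y : measurableType dY} {m : nat}.
Variables (s : X * Y -> R) (Dm : m.-tuple (X * Y)) (alpha : R).
Hypotheses (m_gt0 : (0 < m)%N) (alpha_le1 : alpha <= 1).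

Local Notation grid := (grid s Dm alpha).
Local Notation level := (level s Dm alpha).
Local Notation r := (size grid).
Local Notation C := (conformal_set s Dm).

Lemma full_grid_bounds g : g \in full_grid m alpha -> 0 < g < alpha.
Proof.
rewrite mem_filter => /andP[-> /mapP[k]]; rewrite mem_iota => /andP[k0 _] ->.
by rewrite andbT divr_gt0// ltr0n.
Qed.

Lemma grid_bounds g : g \in grid -> 0 < g < alpha.
Proof. by rewrite mem_filter => /andP[_ /full_grid_bounds]. Qed.

Lemma sorted_full_grid : sorted <%R (full_grid m alpha).
Proof.
apply: (sorted_filter lt_trans); apply: (homo_sorted (e := ltn)).
  by move=> i j ij /=; rewrite ltr_pM2r ?invr_gt0// ltr_nat.
exact: iota_ltn_sorted.
Qed.

Lemma sorted_grid : sorted <%R grid.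
Proof. exact: (sorted_filter lt_trans) sorted_full_grid. Qed.

Lemma uniq_grid : uniq grid.
Proof. exact: sorted_uniq lt_trans (@ltxx _ _) _ sorted_grid. Qed.

(** The level 1 / (m + 1) is the least of the full grid, so it survives the
reduction. *)
Lemma grid_gt0 : 1 / m.+1%:R < alpha -> (0 < r)%N.
Proof.
move=> ha; have : 1 / m.+1%:R \in grid.
  rewrite !mem_filter ha; apply/andP; split; last first.
    by apply/mapP; exists 1%N => //; rewrite mem_iota; lia.
  apply/asboolP => g; rewrite mem_filter => /andP[_ /mapP[k]].
  rewrite mem_iota => /andP[k1 _] -> /=.
  by rewrite ltr_pM2r ?invr_gt0// ltrn1 ltnNge k1.
by case: grid.
Qed.

Lemma level_grid i : (i < r)%N -> level i.+1 \in grid.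
Proof. exact: mem_nth. Qed.

Lemma level_gt0 i : (i < r)%N -> 0 < level i.+1.
Proof. by move=> /level_grid/grid_bounds/andP[]. Qed.

Lemma level_inj i j : (i < r)%N -> (j < r)%N -> level i.+1 = level j.+1 -> i = j.
Proof. by move=> ir jr /eqP; rewrite nth_uniq ?uniq_grid// => /eqP. Qed.

Lemma big_grid (T : Type) (idx : T) (op : T -> T -> T) (F : R -> T) :
  \big[op/idx]_(g <- grid) F g = \big[op/idx]_(i < r) F (level i.+1).
Proof. by rewrite (big_nth 0) big_mkord. Qed.

(** A larger level has a smaller rank, hence a smaller order statistic.  For
levels at most 1 the ceiling in the rank is nonnegative, so that its absolute
value preserves the order. *)
Lemma conformal_set_antitone g g' x : g <= g' -> g' <= 1 -> C g' x `<=` C g x.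
Proof.
move=> gg' g'1 y; rewrite /conformal_set /= => /le_trans; apply.
have rk : (conformal_rank m g' <= conformal_rank m g)%N.
  have c0 (t : R) : t <= 1 -> 0 <= Num.ceil (m.+1%:R * (1 - t)) :> int.
    move=> t1; rewrite ceil_ge0 (lt_le_trans (ltrN10 R))// mulr_ge0//; lra.
  rewrite -lez_nat !gez0_abs ?c0//; last exact: le_trans g'1.
  by apply: le_ceil; rewrite ler_wpM2l//; lra.
rewrite /conformal_quantile; case: ifPn => [h'|h'].
  case: ifPn => [h|_]; last exact: leey.
  rewrite lee_fin; apply: le_sorted_leq_nth.
  - exact: sort_le_sorted.
  - by rewrite inE size_sort size_map size_tuple; lia.
  - by rewrite inE size_sort size_map size_tuple; lia.
  - lia.
by rewrite ifN//; lia.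
Qed.

Lemma level_antitone i k x y : (i <= k < r)%N ->
  C (level k.+1) x y -> C (level i.+1) x y.
Proof.
move=> /andP[ik kr]; have ir := leq_ltn_trans ik kr.
apply: conformal_set_antitone.
  have := sorted_grid; rewrite lt_sorted_uniq_le => /andP[_ le_grid].
  exact: le_sorted_leq_nth.
have /andP[_ /ltW gk] := grid_bounds (level_grid kr).
exact: le_trans gk alpha_le1.
Qed.

Lemma measurable_conformal_set g x : measurable_fun setT s ->
  measurable (C g x).
Proof.
move=> ms; rewrite -[C g x]setTI.
apply: (@emeasurable_fun_infty_c _ _ _ setT (fun y => (s (x, y))%:E)) => //.
by apply/measurable_EFinP; apply: measurableT_comp.
Qed.

End Grid.

(** * Shells and the shortfall function *)

Lemma down_closed_prefix (n : nat) (P : pred nat) :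
  (forall i k, (i <= k < n)%N -> P k -> P i) ->
  exists2 q, (q <= n)%N & forall i, (i < n)%N -> P i = (i < q)%N.
Proof.
move=> Pdown; elim: n Pdown => [|n IH] Pdown; first by exists 0%N.
have [i k ikn|q qn Pq] := IH; first by apply: Pdown; lia.
case Pn : (P n).
  by exists n.+1 => // i iSn; rewrite iSn (Pdown _ n)//; lia.
exists q; first by lia.
move=> i; rewrite ltnS leq_eqVlt => /predU1P[->|]; last exact: Pq.
by rewrite Pn; apply/esym/negbTE; lia.
Qed.

Section Shortfall.
Context {R : realType} {dX dY : measure_display}.
Context {X : measurableType dX} {Y : measurableType dY} {m : nat}.
Variables (s : X * Y -> R) (Dm : m.-tuple (X * Y)) (alpha : R).
Hypotheses (m_gt0 : (0 < m)%N) (alpha_le1 : alpha <= 1).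

Local Notation grid := (grid s Dm alpha).
Local Notation level := (level s Dm alpha).
Local Notation r := (size grid).
Local Notation C := (conformal_set s Dm).
Local Notation shell := (shell s Dm alpha).

(** For a rule with mass p i on the i-th level, the expectation of this function
under Q is the quantity that the ambiguity set bounds by 1 / alpha. *)
Definition shortfall (p : 'I_r -> R) (x : X) (y : Y) : R :=
  \sum_(i < r) p i / level i.+1 * \1_(~` C (level i.+1) x) y.

Lemma shortfall_ge0 (p : 'I_r -> R) x y :
  (forall i, 0 <= p i) -> 0 <= shortfall p x y.
Proof.
move=> p0; apply: sumr_ge0 => i _.
by rewrite mulr_ge0 ?divr_ge0// ltW// (level_gt0 (ltn_ord i)).
Qed.

Lemma shortfallZ k p x y : shortfall (fun i => k * p i) x y = k * shortfall p x y.
Proof. by rewrite mulr_sumr; apply: eq_bigr => i _; rewrite !mulrA. Qed.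

Lemma measurable_shortfall p x : measurable_fun setT s ->
  measurable_fun setT (shortfall p x).
Proof.
move=> ms; apply: measurable_sum => i; apply: measurable_funM => //.
by apply/measurable_indic/measurableC/measurable_conformal_set.
Qed.

Lemma ambiguity_integralE (nu : probability (measurableTypeR R) R)
    (Q : probability Y R) x : measurable_fun setT s ->
  (\int[nu]_(g in [set` grid]) ((1 - Q (C g x)) * (g^-1)%:E) =
   \int[Q]_y (shortfall (fun i => fine (nu [set level i.+1])) x y)%:E)%E.
Proof.
move=> ms.
have mC g : measurable (C g x) by exact: measurable_conformal_set.
have mI (i : 'I_r) : measurable_fun setT (\1_(~` C (level i.+1) x) : Y -> R).
  exact/measurable_indic/measurableC.
rewrite integral_finite_set; last 2 first.
- exact: uniq_grid.
- move=> g /grid_bounds/andP[g0 _]; rewrite -probability_setC//.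
  by rewrite mule_ge0// lee_fin invr_ge0 ltW.
rewrite big_grid /shortfall; under eq_integral do rewrite -sumEFin.
rewrite ge0_integral_sum//; last 2 first.
- move=> i; have mi : measurable_fun setT
      (fun y => fine (nu [set level i.+1]) / level i.+1 *
                \1_(~` C (level i.+1) x) y).
    exact: measurable_funM.
  by move/measurable_EFinP : mi.
- move=> i y _; rewrite lee_fin mulr_ge0// divr_ge0 ?fine_ge0//.
  by rewrite ltW// (level_gt0 (ltn_ord i)).
apply: eq_bigr => i _; under eq_integral do rewrite EFinM.
rewrite ge0_integralZl//; last first.
- rewrite lee_fin divr_ge0 ?fine_ge0//.
  by rewrite ltW// (level_gt0 (ltn_ord i)).
- by move: (mI i) => /measurable_EFinP.
rewrite integral_indic//; last exact: measurableC.
rewrite setIT /= probability_setC// EFinM fineK; last first.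
  by apply: fin_num_measure; exact: measurable_set1.
by rewrite [RHS]muleC muleA [RHS]muleAC.
Qed.

(** Since the regions are nested, the least region that contains y determines
all memberships: y belongs to the j-th shell iff the regions containing y are
those of the first r - j levels. *)
Lemma in_shell x j y : (0 < r)%N -> (j <= r)%N ->
  shell x j y <->
  forall i, (i < r)%N -> C (level i.+1) x y <-> (i.+1 <= r - j)%N.
Proof.
move=> r0 jr; rewrite /shell.
have anti i k : (i <= k < r)%N -> C (level k.+1) x y -> C (level i.+1) x y.
  exact: level_antitone.
case: eqP => [->|/eqP j0].
  rewrite subn0; split => [Cr i ir|/(_ r.-1)]; last first.
    by rewrite prednK// => -[]// _; apply.
  by split => // _; apply: (anti i r.-1); rewrite ?prednK//; lia.
case: eqP => [->|/eqP jr'].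
  rewrite subnn; split => [C1 i ir|/(_ 0%N r0)[nC1 _] C1]; last by have := nC1 C1.
  by split => // Ci; exfalso; apply: C1; apply: (anti 0%N i) => //; lia.
split => [[Cj nCj] i ir|H].
  split => [Ci|ij].
    rewrite leqNgt; apply/negP => ij; apply: nCj.
    by rewrite addn1; apply: (anti _ i) => //; lia.
  by apply: (anti i (r - j).-1); rewrite ?prednK//; lia.
split.
  have -> : (r - j)%N = (r - j).-1.+1 by lia.
  by apply/H; lia.
by rewrite addn1 => /H; lia.
Qed.

Lemma shell_cover x y : (0 < r)%N -> exists2 j, (j <= r)%N & shell x j y.
Proof.
move=> r0.
have [i k ikr /asboolP Ck|q qr Cq] :=
    @down_closed_prefix r (fun i => `[< C (level i.+1) x y >]).
  by apply/asboolP; exact: level_antitone ikr Ck.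
exists (r - q)%N; first exact: leq_subr.
apply/in_shell => //; first exact: leq_subr.
move=> i ir; rewrite subKn// -[(i < q)%N]Cq//.
by split => /asboolP.
Qed.

Lemma shortfall_shell p x j y : (0 < r)%N -> (j <= r)%N -> shell x j y ->
  shortfall p x y =
  \sum_(i < r | (r - j + 1 <= i.+1)%N) p i / level i.+1.
Proof.
move=> r0 jr /in_shell H; have {}H := H r0 jr.
rewrite [RHS]big_mkcond; apply: eq_bigr => i _.
rewrite indicE; case: ifPn => hi.
  rewrite mem_set ?mulr1//= => /H; move/(_ (ltn_ord i)); lia.
rewrite memNset ?mulr0//= => nC; apply: nC; apply/H => //; lia.
Qed.

(** The shells cover the space and the shortfall is constant on each of them, so
bounding the supremum of the cost over every nonempty shell amounts to bounding
the cost at every point. *)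
Lemma regional_constraintsE (D : Type) (c : D -> Y -> R) z t x
    (u : 'I_r -> R) : (0 < r)%N ->
  (forall j, shell_index s Dm alpha x j ->
     (regional_loss s Dm c alpha x z j <=
      (t + \sum_(i < r | (r - j + 1 <= i.+1)%N) u i / level i.+1)%:E)%E) <->
  (forall y, c z y <= t + shortfall u x y).
Proof.
move=> r0; split => [H y|H j [jr _]].
  have [j jr yj] := shell_cover x y r0.
  rewrite (shortfall_shell u r0 jr yj) -lee_fin.
  apply: le_trans (H j _); last by split => //; exists y.
  by apply: ereal_sup_ubound; exists y.
apply: ge_ereal_sup => _ [y yj <-]; rewrite lee_fin.
by rewrite -(shortfall_shell u r0 jr yj).
Qed.

(** Moment duality at b = 1 / alpha, with a point of the innermost region, where
the shortfall vanishes, as Slater point. *)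
Lemma robust_risk_le (nu : probability (measurableTypeR R) R) x
    (f : Y -> R) v : 0 < alpha -> (0 < r)%N -> shell x 0 !=set0 ->
  measurable_fun setT s -> measurable_fun setT f ->
  (robust_risk s Dm alpha nu x f <= v%:E)%E <->
  exists t l : R, [/\ 0 <= l,
    forall y, f y <= t + l * shortfall (fun i => fine (nu [set level i.+1])) x y
    & t + l * alpha^-1 <= v].
Proof.
move=> a0 r0 [y0 y0A] ms mf.
have p0 i : 0 <= fine (nu [set level i.+1]) by exact: fine_ge0.
rewrite -(@moment_duality _ _ _ f _ alpha^-1 v mf (measurable_shortfall _ x ms)
  (fun y => shortfall_ge0 x y _)); last 2 first.
- by [].
- exists y0; rewrite (shortfall_shell _ r0 (leq0n _) y0A).
  rewrite big_pred0 ?invr_gt0// => i; apply/negbTE; have := ltn_ord i; lia.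
split => [H Q hQ|H].
  apply: le_trans H; apply: ereal_sup_ubound; exists Q => //.
  by rewrite /ambiguity_set/= ambiguity_integralE.
apply: ge_ereal_sup => _ [Q hQ <-]; apply: H.
by rewrite -ambiguity_integralE.
Qed.

End Shortfall.

(** * Aggregation rules as weight vectors *)

(** Rules are given by exactly K atoms.  A weight vector with at most K nonzero
entries lists its support first, and the remaining slots, off b, are padding of
weight 0.  The statement for all commutative monoids serves both the real
weights and the extended real values of the measure. *)
Lemma big_pad_support (n K : nat) (P : pred 'I_n) : (0 < n)%N -> (#|P| <= K)%N ->
  exists (f : 'I_K -> 'I_n) (b : pred 'I_K),
    forall (T : Type) (idx : T) (op : Monoid.com_law idx) (F : 'I_n -> T),
      \big[op/idx]_(k | b k) F (f k) = \big[op/idx]_(i | P i) F i.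
Proof.
move=> n0 PK; pose i0 := Ordinal n0.
exists (fun k => nth i0 (enum P) k), (fun k => k < #|P|)%N => T idx op F.
rewrite -[RHS]big_enum/= (big_nth i0) big_mkord -cardE.
by rewrite (big_ord_widen _ (fun k => F (nth i0 (enum P) k)) PK).
Qed.

Section AggregationRules.
Context {R : realType} {dX dY : measure_display}.
Context {X : measurableType dX} {Y : measurableType dY} {m : nat}.
Variables (s : X * Y -> R) (Dm : m.-tuple (X * Y)) (alpha : R).

Local Notation grid := (grid s Dm alpha).
Local Notation level := (level s Dm alpha).
Local Notation r := (size grid).

Implicit Types (nu : probability (measurableTypeR R) R) (p : 'I_r -> R).

Lemma dirac_level (i j : 'I_r) :
  \d_(level i.+1) [set level j.+1] = ((i == j)%:R)%:E :> \bar R.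
Proof.
rewrite diracE; congr ((nat_of_bool _)%:R)%:E; apply/idP/eqP.
  by rewrite inE => /(level_inj (ltn_ord i) (ltn_ord j)) /val_inj.
by move=> ->; rewrite inE.
Qed.

(** Atoms that share a level are merged, which can only shrink the support. *)
Lemma agg_rules_weights nu K : agg_rules s Dm alpha K nu ->
  [/\ forall i : 'I_r, 0 <= fine (nu [set level i.+1]),
      \sum_(i < r) fine (nu [set level i.+1]) = 1
    & (#|[pred i : 'I_r | fine (nu [set level i.+1]) != 0%R]| <= K)%N].
Proof.
move=> [eta [w [eta_grid w0 w1 nuE]]].
have idx k : exists i : 'I_r, eta k = level i.+1.
  have etak := eta_grid k; have kr : (index (eta k) grid < r)%N by rewrite index_mem.
  by exists (Ordinal kr); rewrite /Defs.level/= nth_index.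
pose f k := projT1 (cid (idx k)).
have fE k : eta k = level (f k).+1 by rewrite /f; case: cid.
have pE (i : 'I_r) : fine (nu [set level i.+1]) = \sum_(k | f k == i) w k.
  rewrite nuE; last exact: measurable_set1.
  under eq_bigr do rewrite fE dirac_level -EFinM.
  rewrite sumEFin/= [RHS]big_mkcond; apply: eq_bigr => k _.
  by case: eqP => _; rewrite ?mulr1 ?mulr0.
split.
- by move=> i; rewrite fine_ge0.
- rewrite -w1 (partition_big f predT)//=.
  by apply: eq_bigr => i _; rewrite pE.
- apply: (@leq_trans #|[set f k | k : 'I_K]|); last first.
    by rewrite (leq_trans (leq_imset_card _ _))// card_ord.
  apply/subset_leq_card/fintype.subsetP => i; rewrite inE pE => pi.
  apply/imsetP; apply: contra_neqP pi => nf.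
  by rewrite big_pred0// => k; apply/negP => /eqP ki; apply: nf; exists k.
Qed.

Lemma weights_agg_rules nu p K : (forall i, 0 <= p i) -> \sum_i p i = 1 ->
  (#|[pred i | p i != 0%R]| <= K)%N ->
  (forall A : set (measurableTypeR R), measurable A ->
     nu A = (\sum_i (p i)%:E * \d_(level i.+1) A)%E) ->
  agg_rules s Dm alpha K nu.
Proof.
move=> p0 p1 pK nuE.
have r0 : (0 < r)%N.
  rewrite lt0n; apply: contra_eq_neq p1 => r0.
  rewrite big1 => [|[i ir] _]; first by rewrite eq_sym oner_neq0.
  by exfalso; rewrite r0 in ir.
have [f [b fE]] := big_pad_support r0 pK.
exists (fun k => level (f k).+1), (fun k => if b k then p (f k) else 0); split.
- by move=> k; exact: level_grid.
- by move=> k; case: ifP.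
- rewrite -big_mkcond/= fE big_mkcond/= -p1.
  by apply: eq_bigr => i _; case: eqP.
- move=> A mA; rewrite nuE//.
  transitivity (\sum_(k | b k) ((p (f k))%:E * \d_(level (f k).+1) A))%E.
    rewrite (fE _ _ _ (fun i => (p i)%:E * \d_(level i.+1) A)%E) [RHS]big_mkcond/=.
    by apply: eq_bigr => i _; case: eqP => [->|//]; rewrite mul0e.
  by rewrite big_mkcond; apply: eq_bigr => k _; case: ifP => //; rewrite mul0e.
Qed.

Lemma exists_agg_rule p K : (forall i, 0 <= p i) -> \sum_i p i = 1 ->
  (#|[pred i | p i != 0%R]| <= K)%N ->
  exists nu, [/\ agg_rules s Dm alpha K nu,
    forall A : set (measurableTypeR R), measurable A ->
      nu A = (\sum_i (p i)%:E * \d_(level i.+1) A)%E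
    & forall i : 'I_r, fine (nu [set level i.+1]) = p i].
Proof.
move=> p0 p1 pK.
pose a (i : 'I_r) : measurableTypeR R := level i.+1.
pose nu := atomic_probability a p0 p1.
have nuE (A : set (measurableTypeR R)) : measurable A ->
    nu A = (\sum_i (p i)%:E * \d_(level i.+1) A)%E.
  by move=> _; exact: atomicE.
exists nu; split => //; first exact: weights_agg_rules nuE.
move=> i; rewrite nuE; last exact: measurable_set1.
under eq_bigr do rewrite dirac_level -EFinM.
rewrite sumEFin/= (bigD1 i)//= eqxx mulr1 big1 ?addr0// => j /negbTE ->.
by rewrite mulr0.
Qed.

End AggregationRules.

(** * The change of variables between rules and multipliers *)

Section Reformulation.
Context {R : realType} {dX dY : measure_display}.
Context {X : measurableType dX} {Y : measurableType dY} {m : nat}.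
Context {D : Type}.
Variables (Z : X -> set D) (c : D -> Y -> R).
Variables (s : X * Y -> R) (Dm : m.-tuple (X * Y)) (alpha : R) (K : nat) (x : X).
Hypotheses (mc : forall z, measurable_fun setT (c z)) (ms : measurable_fun setT s).
Hypotheses (m_gt0 : (0 < m)%N) (alpha_gt0 : 0 < alpha) (alpha_le1 : alpha <= 1).
Hypotheses (r_gt0 : (0 < size (grid s Dm alpha))%N) (K_gt0 : (0 < K)%N).
Hypothesis A0 : shell s Dm alpha x 0 !=set0.

Local Notation level := (level s Dm alpha).
Local Notation r := (size (grid s Dm alpha)).
Local Notation risk nu z := (robust_risk s Dm alpha nu x (c z)).
Local Notation agg := (agg_rules s Dm alpha K).
Local Notation feasible :=
  (@reform_feasible R dX dY X Y m s Dm D Z c alpha K x).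
Local Notation objective t u :=
  (reform_objective (s := s) (Dm := Dm) (alpha := alpha) t u).

Let riskP nu z (v : R) :=
  robust_risk_le m_gt0 alpha_le1 nu v alpha_gt0 r_gt0 A0 ms (mc z).

Let constraintsP z t (u : 'I_r -> R) :=
  regional_constraintsE m_gt0 alpha_le1 c z t x u r_gt0.

(** Scaling the weights of the rule by the dual multiplier l makes the constraint
linear and turns the term l / alpha into the sum of u over alpha. *)
Lemma reform_of_rule nu z (v : R) : Z x z -> agg nu -> (risk nu z <= v%:E)%E ->
  exists t u, feasible z t u /\ objective t u <= v.
Proof.
move=> Zz nuK /riskP[t [l [l0 cz tv]]].
have [p0 p1 pK] := agg_rules_weights nuK.
exists t, (\row_i (l * fine (nu [set level i.+1]))).
split; last first.
  rewrite /reform_objective; under eq_bigr do rewrite mxE.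
  by rewrite -mulr_sumr p1 mulr1 mulrC.
split => //.
- by move=> i; rewrite mxE mulr_ge0.
- apply/constraintsP => y.
  apply: le_trans (cz y) _; rewrite lerD2l -shortfallZ.
  by rewrite /shortfall; under [leRHS]eq_bigr do rewrite mxE.
- apply: leq_trans pK; apply/subset_leq_card/fintype.subsetP => i.
  by rewrite !inE mxE mulf_eq0 negb_or => /andP[].
Qed.

(** The multiplier is recovered as the total mass of u and the rule by
normalization. *)
Lemma rule_of_reform z t u : feasible z t u -> 0 < \sum_i u 0 i ->
  exists nu, [/\ agg nu, (risk nu z <= (objective t u)%:E)%E &
    forall A : set (measurableTypeR R), measurable A ->
      nu A = (\sum_(i < r | (0 < u 0%R i)%R)
        (u 0%R i / \sum_j u 0%R j)%:E * \d_(level i.+1) A)%E].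
Proof.
move=> [Zz u0 ucons uK]; set l := \sum_i _ => l0.
have [nu [nuK nuE pE]] : exists nu, [/\ agg nu,
    forall A : set (measurableTypeR R), measurable A ->
      nu A = (\sum_i (u 0%R i / l)%:E * \d_(level i.+1) A)%E
    & forall i : 'I_r, fine (nu [set level i.+1]) = u 0 i / l].
  apply: (@exists_agg_rule _ _ _ _ _ _ s Dm alpha (fun i => u 0 i / l)).
  - by move=> i; rewrite divr_ge0// ltW.
  - by rewrite -mulr_suml divff// gt_eqF.
  - apply: leq_trans uK; apply/subset_leq_card/fintype.subsetP => i.
    by rewrite !inE mulf_eq0 negb_or => /andP[].
exists nu; split => //.
  apply/riskP.
  exists t, l; split; [exact: ltW|move=> y|by rewrite /reform_objective mulrC].
  have := (constraintsP _ _ _).1 ucons y.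
  move/le_trans; apply; rewrite lerD2l -shortfallZ /shortfall.
  by under [leRHS]eq_bigr do rewrite pE mulrCA divff ?gt_eqF// mulr1.
move=> A mA; rewrite nuE// [RHS]big_mkcond/=; apply: eq_bigr => i _.
case: ifPn => // /negP ui; have -> : u 0 i = 0; last by rewrite mul0r mul0e.
by apply/eqP; rewrite eq_le u0 andbT leNgt; exact/negP.
Qed.

(** If u = 0 then t alone bounds the cost, so the multiplier 0 certifies the
bound for every rule, here the one concentrated on the first level. *)
Lemma rule_of_reform_le z t u : feasible z t u ->
  exists2 nu, agg nu & (risk nu z <= (objective t u)%:E)%E.
Proof.
move=> fu; have [Zz u0 ucons uK] := fu.
have : 0 <= \sum_i u 0 i by apply: sumr_ge0.
rewrite le_eqVlt => /predU1P[/esym su0|/(rule_of_reform fu)[nu []]]; last by exists nu.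
pose i0 := Ordinal r_gt0.
have [nu [nuK _ _]] : exists nu, [/\ agg nu,
    forall A : set (measurableTypeR R), measurable A ->
      nu A = (\sum_i ((i == i0)%:R)%:E * \d_(level i.+1) A)%E
    & forall i : 'I_r, fine (nu [set level i.+1]) = (i == i0)%:R].
  apply: (@exists_agg_rule _ _ _ _ _ _ s Dm alpha (fun i => (i == i0)%:R)).
  - by move=> i.
  - by rewrite (bigD1 i0)// big1 ?eqxx /= ?addr0// => i /negbTE ->.
  - apply: leq_trans K_gt0; rewrite (@eq_card _ _ (pred1 i0)) ?card1// => i.
    by rewrite !inE pnatr_eq0 eqb0 negbK.
exists nu => //.
apply/riskP.
exists t, 0; split => //; last by rewrite /reform_objective su0 mul0r mulr0.
move=> y; have := (constraintsP _ _ _).1 ucons y.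
move/le_trans; apply; rewrite lerD2l mul0r /shortfall big1// => i _.
have /eqP := su0; rewrite psumr_eq0// => /allP/(_ i); rewrite mem_index_enum.
by move=> /(_ isT)/eqP ->; rewrite !mul0r.
Qed.

End Reformulation.

(** Reduces comparisons with a robust risk, possibly infinite, to the real
bounds to which duality applies. *)
Lemma lee_real_ub (R : realType) (a b : \bar R) :
  (forall v : R, (b <= v%:E)%E -> (a <= v%:E)%E) -> (a <= b)%E.
Proof.
case: b => [v|_|]; [by apply|exact: leey|].
case: a => [r|H|//]; last by have := H 0%R (leNye _); rewrite leye_eq.
by move=> H; have := H (r - 1)%R (leNye _); rewrite lee_fin => ?; exfalso; lra.
Qed.

Theorem theorem3 (R : realType) (dX dY : measure_display)
  (X : measurableType dX) (Y : measurableType dY)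
  (hX : standard_borel R X) (hY : standard_borel R Y)
  (D : Type) (Z : X -> set D) (c : D -> Y -> R)
  (hc : forall z, measurable_fun setT (c z))
  (s : X * Y -> R) (hs : measurable_fun setT s)
  (m : nat) (hm : (1 <= m)%N) (Dm : m.-tuple (X * Y))
  (alpha : R) (halpha0 : 0 < alpha) (halpha1 : alpha < 1)
  (halpham : 1 / m.+1%:R < alpha)
  (K : nat) (hK : (1 <= K)%N) (x : X)
  (hA0 : shell s Dm alpha x 0 !=set0)
  (hL : forall z, Z x z -> forall j, shell_index s Dm alpha x j ->
          (regional_loss s Dm c alpha x z j < +oo)%E) :
  [/\ joint_value s Dm Z c alpha K x = reform_value s Dm Z c alpha K x,
      (forall (z : D) (v : R), Z x z ->
        (exists2 nu, agg_rules s Dm alpha K nu &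
           (robust_risk s Dm alpha nu x (c z) <= v%:E)%E) <->
        (exists t (u : 'rV[R]_(size (grid s Dm alpha))),
           reform_feasible Z c K x z t u /\
           reform_objective t u <= v))
    & forall (z : D) (t : R) (u : 'rV[R]_(size (grid s Dm alpha))),
        reform_optimal Z c K x z t u ->
        let lambda := \sum_i u 0 i in
        0 < lambda ->
        exists nu : probability (measurableTypeR R) R,
          (forall A : set (measurableTypeR R), measurable A ->
             nu A = (\sum_(i < size (grid s Dm alpha) | (0 < u 0%R i)%R)
                       (u 0%R i / lambda)%:E
                         * \d_(level s Dm alpha i.+1) A)%E) /\
          joint_optimal s Dm Z c alpha K x z nu].
Proof.
have a1 : alpha <= 1 by exact: ltW.
have r0 : (0 < size (grid s Dm alpha))%N by exact: grid_gt0.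
split.
- apply/eqP; rewrite eq_le; apply/andP; split.
    apply: le_ereal_inf_tmp => _ [z [t [u [fu ->]]]].
    have [nu nuK nule] := rule_of_reform_le hc hs hm halpha0 a1 r0 hK hA0 fu.
    apply: le_trans nule; apply: ereal_inf_lbound.
    by case: fu => Zz _ _ _; exists z => //; exists nu.
  apply: le_ereal_inf_tmp => _ [z Zz [nu nuK <-]].
  apply: lee_real_ub => v nuv.
  have [t [u [fu uv]]] := reform_of_rule hc hs hm halpha0 a1 r0 hA0 Zz nuK nuv.
  apply: (@le_trans _ _ (reform_objective t u)%:E); last by rewrite lee_fin.
  by apply: ereal_inf_lbound; exists z, t, u.
- move=> z v Zz; split => [[nu nuK nuv]|[t [u [fu uv]]]].
    exact: reform_of_rule nuv.
  have [nu nuK nule] := rule_of_reform_le hc hs hm halpha0 a1 r0 hK hA0 fu.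
  by exists nu => //; apply: le_trans nule _; rewrite lee_fin.
- move=> z t u [fu umin] lambda lambda0.
  have [nu [nuK nule nuE]] :=
    rule_of_reform hc hs hm halpha0 a1 r0 hA0 fu lambda0.
  exists nu; split => //; split => //; first by case: fu.
  move=> z' nu' Zz' nuK'; apply: le_trans nule _.
  apply: lee_real_ub => v nuv.
  have [t' [u' [fu' uv]]] := reform_of_rule hc hs hm halpha0 a1 r0 hA0 Zz' nuK' nuv.
  by rewrite lee_fin (le_trans (umin _ _ _ fu')).
Qed.
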